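(* Let $D$ be a non-trivial strongly connected digraph. (a) The following are equivalent: (i) $D$ is a bioriented complete graph; (ii) $\mathrm{diam}(D)=1$; (iii) $\overrightarrow{rc}(D)=1$; (iv) $\overrightarrow{src}(D)=1$; (v) $\overrightarrow{rvc}(D)=0$; (vi) $\overrightarrow{srvc}(D)=0$; (vii) $\overrightarrow{trc}(D)=1$; (viii) $\overrightarrow{strc}(D)=1$. (b) $\overrightarrow{strc}(D)\ge \overrightarrow{trc}(D)\ge 3$ if and only if $D$ is not a bioriented complete graph. (c) (i) $\overrightarrow{rc}(D)=2$ iff $\overrightarrow{src}(D)=2$. (ii) $\overrightarrow{rvc}(D)=1$ iff $\overrightarrow{srvc}(D)=1$ iff $\mathrm{diam}(D)=2$. (iii) $\overrightarrow{rvc}(D)=2$ iff $\overrightarrow{srvc}(D)=2$. (iv) $\overrightarrow{trc}(D)=3$ iff $\overrightarrow{strc}(D)=3$. (v) $\overrightarrow{trc}(D)=4$ iff $\overrightarrow{strc}(D)=4$. Moreover, any of the conditions in (c)(i) implies any of the conditions in (c)(iv), and any of the conditions in (c)(i), (c)(iv) and (c)(v) implies any of the conditions in (c)(ii).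
   Context: All digraphs are finite, without loops and without multiple arcs. A digraph is strongly connected if for every ordered pair $(u,v)$ there is a directed $u$–$v$ path; path length is the number of arcs, $d(u,v)$ is the length of a shortest $u$–$v$ path, a $u$–$v$ geodesic is a $u$–$v$ path of length $d(u,v)$, and $\mathrm{diam}(D)=\max d(u,v)$. The biorientation of a graph $G$ replaces each edge $uv$ by the two arcs $uv$ and $vu$; a bioriented complete graph is the biorientation of a complete graph. An arc-coloured path is rainbow if its arcs have distinct colours; a vertex-coloured path is vertex-rainbow if its internal vertices have distinct colours; a total-coloured path (colours on vertices and arcs) is total-rainbow if its arcs and internal vertices all receive pairwise distinct colours. $\overrightarrow{rc}(D)$ (resp. $\overrightarrow{src}(D)$) is the minimum number of colours in an arc-colouring such that every ordered pair $(u,v)$ is joined by a rainbow $u$–$v$ path (resp. rainbow $u$–$v$ geodesic). $\overrightarrow{rvc}(D)$ (resp. $\overrightarrow{srvc}(D)$) is the minimum number of colours in a vertex-colouring such that every ordered pair is joined by a vertex-rainbow path (resp. vertex-rainbow geodesic); in particular this number is $0$ if no internal vertices ever need colouring. $\overrightarrow{trc}(D)$ (resp. $\overrightarrow{strc}(D)$) is the minimum number of colours in a total-colouring such that every ordered pair is joined by a total-rainbow path (resp. total-rainbow geodesic). *)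

(* Defs.v *)
From mathcomp Require Import all_boot.
From mathcomp Require Import boolp.

Set Implicit Arguments.
Unset Strict Implicit.
Unset Printing Implicit Defensive.

(* A digraph without loops and without multiple arcs is an irreflexive        *)
(* relation [arc : rel V] on a finite type [V] of vertices.                   *)

Fact exists_asbool (P : nat -> Prop) : (exists k, P k) -> exists k, `[< P k >].
Proof. by case=> k Pk; exists k; apply/asboolP. Qed.

Definition least (P : nat -> Prop) (exP : exists k, P k) : nat :=
  ex_minn (exists_asbool exP).

Lemma leastP (P : nat -> Prop) (exP : exists k, P k) :
  P (least exP) /\ forall k, P k -> least exP <= k.
Proof.
rewrite /least; case: ex_minnP => m /asboolP Pm min_m.
by split=> // k /asboolP /min_m.
Qed.

Section Biorientation.
Variable V : finType.

(* The edges of an undirected graph on [V] are two-element subsets of [V].    *)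
Definition biorientation (E : {set {set V}}) : rel V :=
  fun u v => [set u; v] \in E.

Definition complete_edges : {set {set V}} := [set e : {set V} | #|e| == 2].

Definition bioriented_complete (arc : rel V) : Prop :=
  arc =2 biorientation complete_edges.

End Biorientation.

Section Paths.
Variables (V : finType) (arc : rel V).

(* A path is given by its first vertex [u] and the sequence [p] of the        *)
(* vertices that follow, so that its length is [size p].                      *)
Definition dipath (u v : V) (p : seq V) : bool :=
  [&& path arc u p, last u p == v & uniq (u :: p)].

Definition strongly_connected : Prop := forall u v, exists p, dipath u v p.

Definition path_arcs (u : V) (p : seq V) : seq (V * V) := pairmap pair u p.

Definition internal (u : V) (p : seq V) : seq V := behead (belast u p).

Hypothesis sc : strongly_connected.

Fact path_length_exists u v : exists n, exists2 p, dipath u v p & size p = n.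
Proof. by have [p uvp] := sc u v; exists (size p), p. Qed.

Definition dist (u v : V) : nat := least (path_length_exists u v).

Definition geodesic (u v : V) (p : seq V) : bool :=
  dipath u v p && (size p == dist u v).

Definition diam : nat := \max_(u : V) \max_(v : V) dist u v.

Fact geodesic_exists u v : exists p, geodesic u v p.
Proof.
have [[p uvp sz_p] _] := leastP (path_length_exists u v).
by exists p; rewrite /geodesic uvp sz_p eqxx.
Qed.

End Paths.

Section Colourings.
Variable V : finType.

(* Arc-colourings are defined on all pairs of vertices; only their values on  *)
(* arcs ever matter.                                                          *)

Definition arc_rainbow k (c : V * V -> 'I_k) (u : V) (p : seq V) : bool :=
  uniq (map c (path_arcs u p)).

(* Vertices may be left uncoloured ([None]), but the internal vertices of a   *)
(* vertex-rainbow path must be coloured. Thus 0 colours suffice exactly when  *)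
(* no internal vertex needs a colour; for k > 0 this is the same as colouring *)
(* all the vertices, see [vertex_colourable_total].                           *)
Definition vertex_rainbow k (c : V -> option 'I_k) (u : V) (p : seq V) : bool :=
  all (fun x => c x != None) (internal u p) && uniq (map c (internal u p)).

Definition total_rainbow k (cV : V -> 'I_k) (cA : V * V -> 'I_k)
    (u : V) (p : seq V) : bool :=
  uniq (map cA (path_arcs u p) ++ map cV (internal u p)).

(* [Q u v p] selects the admissible u-v paths: all of them, or geodesics.     *)
Variable Q : V -> V -> seq V -> bool.

Definition arc_colourable (k : nat) : Prop :=
  exists c : V * V -> 'I_k,
    forall u v, exists2 p, Q u v p & arc_rainbow c u p.

Definition vertex_colourable (k : nat) : Prop :=
  exists c : V -> option 'I_k,
    forall u v, exists2 p, Q u v p & vertex_rainbow c u p.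

Definition total_colourable (k : nat) : Prop :=
  exists (cV : V -> 'I_k) (cA : V * V -> 'I_k),
    forall u v, exists2 p, Q u v p & total_rainbow cV cA u p.

Lemma vertex_colourable_total k : 0 < k ->
  vertex_colourable k <->
  exists c : V -> 'I_k,
    forall u v, exists2 p, Q u v p & uniq (map c (internal u p)).
Proof.
case: k => // k _; split=> [[c Hc]|[c Hc]].
  exists (fun x => odflt ord0 (c x)) => u v.
  have [p Qp /andP[/allP cp Uc]] := Hc u v; exists p => //.
  rewrite -(map_inj_uniq (@Some_inj _)) -map_comp.
  congr (is_true (uniq _)): Uc; apply/eq_in_map => x /cp /=.
  by case: (c x).
exists (fun x => Some (c x)) => u v; have [p Qp Uc] := Hc u v; exists p => //.
rewrite /vertex_rainbow all_predT (map_comp Some c).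
by rewrite (map_inj_uniq (@Some_inj _)).
Qed.

Hypothesis Qex : forall u v, exists p, Q u v p.
Hypothesis Quniq : forall u v p, Q u v p -> uniq (u :: p).

Fact path_arcs_uniq (u : V) (p : seq V) : uniq (u :: p) -> uniq (path_arcs u p).
Proof.
case/andP=> _ Up; apply: (@map_uniq _ _ snd).
suff ->: map snd (path_arcs u p) = p by [].
by rewrite /path_arcs; elim: p u {Up} => //= x p IH u; rewrite IH.
Qed.

Fact internal_uniq (u : V) (p : seq V) : uniq (u :: p) -> uniq (internal u p).
Proof.
rewrite lastI rcons_uniq /internal => /andP[_].
by case: (belast u p) => //= x s /andP[].
Qed.

Fact arc_colourable_exists : exists k, arc_colourable k.
Proof.
exists #|{: V * V}|; exists (fun a : V * V => enum_rank a) => u v; have [p Qp] := Qex u v; exists p => //.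
by rewrite /arc_rainbow (map_inj_uniq enum_rank_inj) path_arcs_uniq ?(Quniq Qp).
Qed.

Fact vertex_colourable_exists : exists k, vertex_colourable k.
Proof.
exists #|V|; exists (fun x => Some (enum_rank x)) => u v.
have [p Qp] := Qex u v; exists p => //.
rewrite /vertex_rainbow all_predT map_inj_uniq ?internal_uniq ?(Quniq Qp) //.
by move=> x y [] /enum_rank_inj.
Qed.

Fact total_colourable_exists : exists k, total_colourable k.
Proof.
exists #|{: V + V * V}|; exists (fun x => enum_rank (inl x : V + V * V)).
exists (fun a => enum_rank (inr a : V + V * V)) => u v; have [p Qp] := Qex u v; exists p => //.
have Up := Quniq Qp; rewrite /total_rainbow cat_uniq.
rewrite !map_inj_uniq ?path_arcs_uniq ?internal_uniq //=; last first.
- by move=> x y /enum_rank_inj [].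
- by move=> x y /enum_rank_inj [].
rewrite andbT; apply/hasPn => _ /mapP[x _ ->].
by apply/negP => /mapP[a _ /enum_rank_inj].
Qed.

End Colourings.

Section ConnectionNumbers.
Variables (V : finType) (arc : rel V) (sc : strongly_connected arc).

Fact dipath_uniq u v p : dipath arc u v p -> uniq (u :: p).
Proof. by case/and3P. Qed.

Fact geodesic_uniq u v p : geodesic sc u v p -> uniq (u :: p).
Proof. by case/andP=> /dipath_uniq. Qed.

Definition rc : nat := least (arc_colourable_exists sc dipath_uniq).
Definition src : nat :=
  least (arc_colourable_exists (geodesic_exists sc) geodesic_uniq).

Definition rvc : nat := least (vertex_colourable_exists sc dipath_uniq).
Definition srvc : nat :=
  least (vertex_colourable_exists (geodesic_exists sc) geodesic_uniq).

Definition trc : nat := least (total_colourable_exists sc dipath_uniq).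
Definition strc : nat :=
  least (total_colourable_exists (geodesic_exists sc) geodesic_uniq).

End ConnectionNumbers.

(* Main.v *)
(* A rainbow path with few colours is short, which bounds the diameter by each
   of the connection numbers.  Conversely, a path with at most one arc is
   rainbow in every arc- or total-colouring, and one with at most two arcs in
   every vertex-colouring.  When the number of colours is so small (2, 2 and 4
   for arcs, vertices and total colourings) that rainbow paths can only be one
   arc longer than these trivially rainbow ones, a pair of vertices is joined
   by a rainbow path iff it is joined by a rainbow geodesic. *)
Require Import Defs.
From mathcomp Require Import all_boot.
From mathcomp Require Import zify.

Set Implicit Arguments.
Unset Strict Implicit.
Unset Printing Implicit Defensive.

(** * Comparing least elements *)

Lemma least_le_least (P P' : nat -> Prop) (exP : exists k, P k)
    (exP' : exists k, P' k) :
  (forall k, P' k -> P k) -> least exP <= least exP'.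
Proof.
move=> sub; have [P'm _] := leastP exP'; have [_ min_m] := leastP exP.
exact: min_m (sub _ P'm).
Qed.

(** If one minimum equals [m], agreement at [m] bounds the other by [m], so both minima lie in the
    range where the predicates agree. *)
Lemma least_eq_iff (P P' : nat -> Prop) (exP : exists k, P k)
    (exP' : exists k, P' k) m :
  (forall k, k <= m -> P k <-> P' k) -> least exP = m <-> least exP' = m.
Proof.
move=> PP'; have [Pl minP] := leastP exP; have [P'l minP'] := leastP exP'.
split=> lm; apply/eqP; rewrite eqn_leq.
  have le' : least exP' <= m by apply: minP'; apply/PP'; rewrite // -lm.
  by rewrite le' -{1}lm minP //; apply/(PP' _ le').
have le : least exP <= m by apply: minP; apply/PP'; rewrite // -lm.
by rewrite le -{1}lm minP' //; apply/(PP' _ le).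
Qed.

Lemma size_map_uniq_ord (T : Type) k (c : T -> 'I_k) (s : seq T) :
  uniq (map c s) -> size s <= k.
Proof.
move=> Us; have := max_card (mem (map c s)).
by rewrite (card_uniqP Us) card_ord size_map.
Qed.

Lemma uniq_short (T : eqType) (s : seq T) : size s <= 1 -> uniq s.
Proof. by case: s => [|x []]. Qed.

(** * Lengths of rainbow paths *)

Section RainbowPaths.
Variable V : finType.
Implicit Types (u v : V) (p : seq V).

Lemma size_path_arcs u p : size (path_arcs u p) = size p.
Proof. exact: size_pairmap. Qed.

Lemma size_internal u p : size (internal u p) = (size p).-1.
Proof. by rewrite size_behead size_belast. Qed.

Lemma internal_short u p : size p <= 1 -> internal u p = [::].
Proof. by move=> p1; apply/nilP; rewrite /nilp size_internal; lia. Qed.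

Lemma size_arc_rainbow k (c : V * V -> 'I_k) u p :
  arc_rainbow c u p -> size p <= k.
Proof. by move/size_map_uniq_ord; rewrite size_path_arcs. Qed.

Lemma size_vertex_rainbow k (c : V -> option 'I_k) u p :
  vertex_rainbow c u p -> size p <= k.+1.
Proof.
case/andP=> /allP c_int Uc.
(* Adjoining [None] to the colours used keeps them distinct, and [option 'I_k] has [k.+1]
   elements. *)
have NoneU : None \notin map c (internal u p).
  by apply/mapP=> -[x /c_int /eqP cx eq_cx]; case: cx.
have := max_card (mem (None :: map c (internal u p))).
rewrite (card_uniqP _) /= ?NoneU // card_option card_ord size_map size_internal.
lia.
Qed.

(** A path with n > 0 arcs has n - 1 internal vertices, so 2n - 1 distinct colours are needed. *)
Lemma size_total_rainbow k (cV : V -> 'I_k) (cA : V * V -> 'I_k) u p :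
  total_rainbow cV cA u p -> size p <= k.+1./2.
Proof.
move=> Uc; have := max_card (mem (map cA (path_arcs u p) ++ map cV (internal u p))).
rewrite (card_uniqP Uc) card_ord size_cat !size_map size_path_arcs size_internal.
lia.
Qed.

Lemma arc_rainbow_short k (c : V * V -> 'I_k) u p :
  size p <= 1 -> arc_rainbow c u p.
Proof. by move=> p1; apply: uniq_short; rewrite size_map size_path_arcs. Qed.

Lemma vertex_rainbow_short k (c : V -> option 'I_k) u p :
  size p <= 1 -> vertex_rainbow c u p.
Proof. by move=> p1; rewrite /vertex_rainbow internal_short. Qed.

Lemma total_rainbow_short k (cV : V -> 'I_k) (cA : V * V -> 'I_k) u p :
  size p <= 1 -> total_rainbow cV cA u p.
Proof.
move=> p1; rewrite /total_rainbow internal_short // cats0.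
exact: arc_rainbow_short.
Qed.

(* Vertices receive the new colour [k]. *)
Lemma total_colourable_of_arc (Q : V -> V -> seq V -> bool) k :
  (forall u v p, Q u v p -> size p <= 2) ->
  arc_colourable Q k -> total_colourable Q k.+1.
Proof.
move=> Q2 [c Hc]; exists (fun=> ord_max), (widen_ord (leqnSn k) \o c) => u v.
have [p Qp Uc] := Hc u v; exists p => //.
rewrite /total_rainbow cat_uniq map_comp; apply/and3P; split.
- by rewrite map_inj_uniq // => i j /(congr1 val) /= /val_inj.
- apply/hasPn=> _ /mapP[x _ ->]; apply/mapP=> -[i _ /(congr1 val) /= eq_k].
  by have := ltn_ord i; rewrite -eq_k ltnn.
(* At most one internal vertex occurs, so the constant vertex colour is never repeated. *)
- apply: uniq_short; rewrite size_map size_internal.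
  by have := Q2 _ _ _ Qp; lia.
Qed.

End RainbowPaths.

(** * Distance, diameter and geodesics *)

Section Numbers.
Variables (V : finType) (arc : rel V) (sc : strongly_connected arc).
Implicit Types (u v : V) (p : seq V).

Lemma geodesic_dipath u v p : geodesic sc u v p -> dipath arc u v p.
Proof. by case/andP. Qed.

Lemma dist_le u v p : dipath arc u v p -> dist sc u v <= size p.
Proof.
move=> uvp; have [_] := leastP (path_length_exists sc u v).
by apply; exists p.
Qed.

Lemma dist_le_diam u v : dist sc u v <= diam sc.
Proof.
apply: leq_trans (leq_bigmax (F := fun u => \max_v dist sc u v) u).
exact: (leq_bigmax (F := dist sc u) v).
Qed.

Lemma size_geodesic u v p : geodesic sc u v p -> size p <= diam sc.
Proof. by case/andP=> _ /eqP->; apply: dist_le_diam. Qed.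

Lemma diam_le n :
  (forall u v, exists2 p, dipath arc u v p & size p <= n) -> diam sc <= n.
Proof.
move=> short; apply/bigmax_leqP=> u _; apply/bigmax_leqP=> v _.
by have [p /dist_le uvp] := short u v; apply: leq_trans.
Qed.

Lemma diam_gt0 : 1 < #|V| -> 0 < diam sc.
Proof.
case/card_gt1P=> u [v] [_ _]; apply: contraNT; rewrite -leqNgt => d0.
have [p uvp] := geodesic_exists sc u v; have := size_geodesic uvp.
have /and3P[_ /eqP + _] := geodesic_dipath uvp.
by case: p {uvp} => [/= -> //|x p _ /=]; lia.
Qed.

Lemma diam_le1P : irreflexive arc -> bioriented_complete arc <-> diam sc <= 1.
Proof.
move=> irr; rewrite /bioriented_complete /biorientation; split=> [complete|d1 u v].
  apply: diam_le => u v; have [<-|neq_uv] := eqVneq u v.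
    by exists [::] => //; rewrite /dipath /= eqxx.
  exists [:: v] => //.
  by rewrite /dipath /= complete !inE cards2 neq_uv !eqxx.
rewrite !inE cards2; have [<-|neq_uv] := eqVneq u v; first exact: irr.
have [p uvp] := geodesic_exists sc u v; have := size_geodesic uvp.
have /and3P[+ /eqP + _] := geodesic_dipath uvp.
case: p {uvp} => [_ /= eq_uv|x [|y p] /=]; first by rewrite eq_uv eqxx in neq_uv.
  by rewrite andbT => ? <-.
by lia.
Qed.

(** At distance at most [b], every geodesic satisfies [R]. At a larger distance, the given path has
    length at most [b.+1], hence is itself a geodesic. *)
Lemma rainbow_geodesic (R : V -> seq V -> bool) b :
  (forall u p, R u p -> size p <= b.+1) ->
  (forall u p, size p <= b -> R u p) ->
  (forall u v, exists2 p, dipath arc u v p & R u p) ->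
  forall u v, exists2 p, geodesic sc u v p & R u p.
Proof.
move=> Rle leR HR u v; have [p uvp Rp] := HR u v.
have [db|bd] := leqP (dist sc u v) b.
  have [q uvq] := geodesic_exists sc u v; exists q => //.
  by apply: leR; case/andP: uvq => _ /eqP->.
by exists p => //; rewrite /geodesic uvp eqn_leq dist_le // (leq_trans (Rle _ _ Rp)).
Qed.

(** * Transfer between paths and geodesics *)

Lemma geodesic_arc_colourable k :
  arc_colourable (geodesic sc) k -> arc_colourable (dipath arc) k.
Proof.
by case=> c Hc; exists c => u v; have [p /geodesic_dipath ? ?] := Hc u v; exists p.
Qed.

Lemma geodesic_vertex_colourable k :
  vertex_colourable (geodesic sc) k -> vertex_colourable (dipath arc) k.
Proof.
by case=> c Hc; exists c => u v; have [p /geodesic_dipath ? ?] := Hc u v; exists p.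
Qed.

Lemma geodesic_total_colourable k :
  total_colourable (geodesic sc) k -> total_colourable (dipath arc) k.
Proof.
case=> cV [cA Hc]; exists cV, cA => u v.
by have [p /geodesic_dipath ? ?] := Hc u v; exists p.
Qed.

Lemma arc_colourable_geodesic k : k <= 2 ->
  arc_colourable (dipath arc) k <-> arc_colourable (geodesic sc) k.
Proof.
move=> k2; split; last exact: geodesic_arc_colourable.
case=> c Hc; exists c; apply: (rainbow_geodesic (b := 1)) Hc => u p.
  by move/size_arc_rainbow/leq_trans; apply.
exact: arc_rainbow_short.
Qed.

Lemma vertex_colourable_geodesic k : k <= 2 ->
  vertex_colourable (dipath arc) k <-> vertex_colourable (geodesic sc) k.
Proof.
move=> k2; split; last exact: geodesic_vertex_colourable.
(* Without colours, a path with two arcs has an uncoloured internal vertex, so only [b = 1] is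
   possible. For [k > 0] the colouring can be made total; then two arcs are always harmless and
   [b = 2] works. *)
case: (posnP k) => [-> [c Hc]|k0].
  exists c; apply: (rainbow_geodesic (b := 1)) Hc => u p.
    by move/size_vertex_rainbow/leq_trans; apply.
  exact: vertex_rainbow_short.
rewrite !vertex_colourable_total // => -[c Hc]; exists c.
pose R u p := uniq (map c (internal u p)).
apply: (rainbow_geodesic (R := R) (b := 2)) Hc => u p.
  by move/size_map_uniq_ord; rewrite size_internal; lia.
by move=> p2; apply: uniq_short; rewrite size_map size_internal; lia.
Qed.

Lemma total_colourable_geodesic k : k <= 4 ->
  total_colourable (dipath arc) k <-> total_colourable (geodesic sc) k.
Proof.
move=> k4; split; last exact: geodesic_total_colourable.
case=> cV [cA Hc]; exists cV, cA; apply: (rainbow_geodesic (b := 1)) Hc => u p.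
  (* [k <= 4] is exactly what keeps [k.+1./2] at most 2. *)
  by move/size_total_rainbow; lia.
exact: total_rainbow_short.
Qed.

Lemma rc_le_src : rc sc <= src sc.
Proof. exact/least_le_least/geodesic_arc_colourable. Qed.

Lemma rvc_le_srvc : rvc sc <= srvc sc.
Proof. exact/least_le_least/geodesic_vertex_colourable. Qed.

Lemma trc_le_strc : trc sc <= strc sc.
Proof. exact/least_le_least/geodesic_total_colourable. Qed.

Lemma rc_eq_src m : m <= 2 -> rc sc = m <-> src sc = m.
Proof.
move=> m2; apply: least_eq_iff => k km.
exact/arc_colourable_geodesic/(leq_trans km).
Qed.

Lemma rvc_eq_srvc m : m <= 2 -> rvc sc = m <-> srvc sc = m.
Proof.
move=> m2; apply: least_eq_iff => k km.
exact/vertex_colourable_geodesic/(leq_trans km).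
Qed.

Lemma trc_eq_strc m : m <= 4 -> trc sc = m <-> strc sc = m.
Proof.
move=> m4; apply: least_eq_iff => k km.
exact/total_colourable_geodesic/(leq_trans km).
Qed.

(** * Bounds between the diameter and the connection numbers *)

Lemma diam_le_rc : diam sc <= rc sc.
Proof.
have [[c Hc] _] := leastP (arc_colourable_exists sc (@dipath_uniq _ arc)).
apply: diam_le => u v; have [p uvp /size_arc_rainbow ?] := Hc u v.
by exists p.
Qed.

Lemma diam_le_rvc : diam sc <= (rvc sc).+1.
Proof.
have [[c Hc] _] := leastP (vertex_colourable_exists sc (@dipath_uniq _ arc)).
apply: diam_le => u v; have [p uvp /size_vertex_rainbow ?] := Hc u v.
by exists p.
Qed.

Lemma diam_le_trc : diam sc <= (trc sc).+1./2.
Proof.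
have [[cV [cA Hc]] _] := leastP (total_colourable_exists sc (@dipath_uniq _ arc)).
apply: diam_le => u v; have [p uvp /size_total_rainbow ?] := Hc u v.
by exists p.
Qed.

Lemma src_le1 : diam sc <= 1 -> src sc <= 1.
Proof.
move=> d1; apply: (proj2 (leastP _)); exists (fun=> ord0) => u v.
have [p uvp] := geodesic_exists sc u v; exists p => //.
exact/arc_rainbow_short/(leq_trans (size_geodesic uvp)).
Qed.

Lemma srvc_le0 : diam sc <= 1 -> srvc sc <= 0.
Proof.
move=> d1; apply: (proj2 (leastP _)); exists (fun=> None) => u v.
have [p uvp] := geodesic_exists sc u v; exists p => //.
exact/vertex_rainbow_short/(leq_trans (size_geodesic uvp)).
Qed.

(** Geodesics have at most one internal vertex, so a constant colouring suffices. *)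
Lemma srvc_le1 : diam sc <= 2 -> srvc sc <= 1.
Proof.
move=> d2; apply: (proj2 (leastP _)); rewrite vertex_colourable_total //.
exists (fun=> ord0) => u v.
have [p uvp] := geodesic_exists sc u v; exists p => //.
apply: uniq_short; rewrite size_map size_internal.
by have := size_geodesic uvp; lia.
Qed.

Lemma strc_le1 : diam sc <= 1 -> strc sc <= 1.
Proof.
move=> d1; apply: (proj2 (leastP _)); exists (fun=> ord0), (fun=> ord0) => u v.
have [p uvp] := geodesic_exists sc u v; exists p => //.
exact/total_rainbow_short/(leq_trans (size_geodesic uvp)).
Qed.

Lemma strc_le_src : diam sc <= 2 -> strc sc <= (src sc).+1.
Proof.
move=> d2; apply: (proj2 (leastP _)); apply: total_colourable_of_arc.
  by move=> u v p /size_geodesic /leq_trans; apply.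
exact: (proj1 (leastP _)).
Qed.

End Numbers.

Theorem theorem2 (V : finType) (arc : rel V) (arc_irr : irreflexive arc)
    (nontrivial : 1 < #|V|) (sc : strongly_connected arc) :
  (* (a) *)
  [<-> bioriented_complete arc;
       diam sc = 1;
       rc sc = 1;
       src sc = 1;
       rvc sc = 0;
       srvc sc = 0;
       trc sc = 1;
       strc sc = 1]
  /\
  (* (b) *)
  (strc sc >= trc sc /\ trc sc >= 3 <-> ~ bioriented_complete arc)
  /\
  (* (c) *)
  (rc sc = 2 <-> src sc = 2) /\
  [<-> rvc sc = 1; srvc sc = 1; diam sc = 2] /\
  (rvc sc = 2 <-> srvc sc = 2) /\
  (trc sc = 3 <-> strc sc = 3) /\
  (trc sc = 4 <-> strc sc = 4) /\
  (rc sc = 2 \/ src sc = 2 -> trc sc = 3 /\ strc sc = 3) /\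
  (rc sc = 2 \/ src sc = 2 \/ trc sc = 3 \/ strc sc = 3 \/
     trc sc = 4 \/ strc sc = 4 ->
   rvc sc = 1 /\ srvc sc = 1 /\ diam sc = 2).
Proof.
(* Once these facts are collected, the seven numbers are generalised and only arithmetic and
   propositional reasoning remain. *)
have := diam_le1P sc arc_irr; have := diam_gt0 sc nontrivial.
have := rc_le_src sc; have := rvc_le_srvc sc; have := trc_le_strc sc.
have := diam_le_rc sc; have := diam_le_rvc sc; have := diam_le_trc sc.
have := @src_le1 _ _ sc; have := @srvc_le0 _ _ sc; have := @srvc_le1 _ _ sc.
have := @strc_le1 _ _ sc; have := @strc_le_src _ _ sc.
have := rc_eq_src sc (leqnn 2); have := rvc_eq_srvc sc (leqnn 2).
have := trc_eq_strc sc (isT : 3 <= 4); have := trc_eq_strc sc (leqnn 4).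
move: (diam sc) (rc sc) (src sc) (rvc sc) (srvc sc) (trc sc) (strc sc).
move: (bioriented_complete arc) => complete d r s rv srv t st.
move=> t4 t3 rv2 r2 st_s st1 srv1 srv0 s1 d_t d_rv d_r t_st rv_srv r_s d0 completeP.
(* [t <= 4] forces [d <= 2], while [d <= 1] would give [t <= st <= 1]. *)
have t34 : t = 3 \/ t = 4 -> rv = 1 /\ srv = 1 /\ d = 2.
  by clear -st1 t_st d_t srv1 d_rv rv_srv d0; move=> t34; have: 1 < d <= 2; lia.
(* Here [d = 2], since [d <= 1] would give [s <= 1]. Then [t <= st <= s.+1 = 3], and [d <= t.+1./2]
   gives [3 <= t]. *)
have r2_t3 : r = 2 -> t = 3.
  move=> r_2; have s_2 := proj1 r2 r_2.
  by clear -s_2 r_2 d_r s1 st_s t_st d_t; have: 1 < d <= 2; lia.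
have r2_t34 : r = 2 \/ s = 2 -> t = 3 /\ st = 3.
  by rewrite -r2 -t3 => -[] /r2_t3.
split.
  (* If [d <= 1], all eight conditions hold; otherwise all fail, because [r >= 2], [rv >= 1] and
     [t >= 3]. *)
  clear t3 t4 rv2 r2 st_s t34 r2_t3 r2_t34; case: (leqP d 1) completeP => d1 completeP.
    have {}st1 := st1 d1; have {}s1 := s1 d1; have {}srv0 := srv0 d1.
    by tfae; rewrite ?completeP; lia.
  by tfae; rewrite ?completeP; lia.
split; first by rewrite completeP; clear -d0 d_t t_st st1; lia.
split=> //; split; first by clear -d_rv rv_srv srv0 srv1 d0; tfae; lia.
do 4![split=> //].
(* Each of the six alternatives is reduced to [t = 3] or [t = 4]. *)
by case=> [/r2_t3|[/r2/r2_t3|[|[/t3|[|/t4]]]]] ?; apply: t34; tauto.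
Qed.
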